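(* Let $(P_n)_{n\ge0}$ be the polynomials satisfying $$xP_n=\lambda_nP_{n+1}+\lambda_{n-1}P_{n-1},\quad n\ge 0,$$ with $P_{-1}=\lambda_{-1}=0$, $P_0=1$ and $\lambda_n>0$ for $n\ge 0$. If the sequence $(\lambda_n)_{n\ge0}$ is increasing and $\lim_{n\to\infty}\lambda_n=L<\infty$, then $$P_n^2(x)+P_{n-1}^2(x)\ge\frac{\lambda_0^2}{2L^2}\qquad\text{for all } x\in\mathbb R,\ n\ge1;$$ in particular $\inf\{P_{n-1}^2(x)+P_n^2(x)\mid x\in\mathbb R,\ n\ge 1\}>0$.
   Context: ''Increasing'' is meant in the weak sense. *)

(* Defs.v *)
From HB Require Import structures.
From mathcomp Require Import all_boot all_order all_algebra.
From mathcomp Require Import all_classical all_reals all_analysis.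

Set Implicit Arguments.
Unset Strict Implicit.
Unset Printing Implicit Defensive.

Import Order.TTheory GRing.Theory Num.Theory.
Import numFieldNormedType.Exports.

Local Open Scope classical_set_scope.
Local Open Scope ring_scope.

(* [prev u n] is u_(n-1), with the convention u_(-1) = 0. *)
Definition prev (V : nmodType) (u : nat -> V) (n : nat) : V :=
  if n is m.+1 then u m else 0.

Definition jacobi_recurrence (R : realType) (lambda : nat -> R)
    (P : nat -> {poly R}) : Prop :=
  P 0%N = 1 /\
  forall n : nat,
    'X * P n = lambda n *: P n.+1 + prev lambda n *: prev P n.

(* Main.v *)
(* Write p_n = P_n(x) and
   E_n = lambda_n^2 (p_n^2 + p_(n+1)^2) - lambda_n x p_n p_(n+1).
   The recurrence gives E_(n+1) - E_n = (lambda_(n+1)^2 - lambda_n^2) p_(n+1)^2,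
   so E_n >= E_0 = lambda_0^2, and for |x| <= 2L one has
   E_n <= 2L^2 (p_n^2 + p_(n+1)^2). For |x| >= 2L the sequence |p_n| increases
   from p_0 = 1, and lambda_0 <= L. *)

Require Import Defs.
From HB Require Import structures.
From mathcomp Require Import all_boot all_order all_algebra.
From mathcomp Require Import all_classical all_reals all_analysis.
From mathcomp Require Import ring lra.

Set Implicit Arguments.
Unset Strict Implicit.
Unset Printing Implicit Defensive.

Import Order.TTheory GRing.Theory Num.Theory.
Import numFieldNormedType.Exports.

Local Open Scope classical_set_scope.
Local Open Scope ring_scope.

Section ThreeTermRecurrence.
Variables (R : realFieldType) (a p : nat -> R) (x : R).
Hypothesis a_gt0 : forall n, 0 < a n.
Hypothesis a_incr : forall n, a n <= a n.+1.
Hypothesis p0 : p 0%N = 1.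
Hypothesis p_rec :
  forall n, x * p n = a n * p n.+1 + Defs.prev a n * Defs.prev p n.

Lemma energy_ge n :
  a 0%N ^+ 2 <= a n ^+ 2 * (p n ^+ 2 + p n.+1 ^+ 2) - a n * x * p n * p n.+1.
Proof.
elim: n => [|n IHn].
  have := p_rec 0%N; rewrite /= p0 !mulr1 mulr0 addr0 => ->.
  by rewrite le_eqVlt; apply/orP; left; apply/eqP; ring.
apply: le_trans IHn _; have /= rec := p_rec n.+1; rewrite -subr_ge0.
(* The last product is a multiple of the recurrence at [n.+1], hence zero; what remains is
   nonnegative by monotonicity of [a]. *)
have -> : a n.+1 ^+ 2 * (p n.+1 ^+ 2 + p n.+2 ^+ 2)
      - a n.+1 * x * p n.+1 * p n.+2
    - (a n ^+ 2 * (p n ^+ 2 + p n.+1 ^+ 2) - a n * x * p n * p n.+1)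
  = (a n.+1 ^+ 2 - a n ^+ 2) * p n.+1 ^+ 2
    + (a n.+1 * p n.+2 - a n * p n)
      * (a n.+1 * p n.+2 + a n * p n - x * p n.+1) by ring.
rewrite rec subrr mulr0 addr0 mulr_ge0 ?sqr_ge0// subr_ge0.
by rewrite ler_pXn2r ?nnegrE ?(ltW (a_gt0 _)).
Qed.

Variable L : R.
Hypothesis a_le : forall n, a n <= L.

(** If |p_(m-1)| <= |p_m|, the recurrence gives 2L |p_m| <= a_m |p_(m+1)| + L |p_m|, so a_m |p_m| <=
    L |p_m| <= a_m |p_(m+1)|. *)
Lemma norm_le_next n : 2 * L <= `|x| -> `|p n| <= `|p n.+1|.
Proof.
(* Shifting the index by one lets the induction start from p_(-1) = 0. *)
move=> xL; have prev_le m : `|Defs.prev p m| <= `|p m|.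
  elim: m => [|m IHm] /=; first by rewrite normr0.
  have prev_a : 0 <= Defs.prev a m <= L.
    case: m {IHm} => [|m] /=; last by rewrite a_le ltW.
    by rewrite lexx (le_trans (ltW (a_gt0 0)) (a_le 0)).
  have : `|x| * `|p m| <= a m * `|p m.+1| + Defs.prev a m * `|Defs.prev p m|.
    rewrite -normrM p_rec (le_trans (ler_normD _ _))// !normrM.
    by rewrite (gtr0_norm (a_gt0 m)) (ger0_norm (andP prev_a).1).
  have am := a_gt0 m; have amL := a_le m; have pm := normr_ge0 (p m).
  have := ler_wpM2r pm xL; have := ler_wpM2r pm amL.
  have := ler_pM (andP prev_a).1 (normr_ge0 _) (andP prev_a).2 IHm.
  by move=> h1 h2 h3 h4; rewrite -(ler_pM2l am); lra.
exact: prev_le n.+1.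
Qed.

Lemma sqr_sum_ge n :
  a 0%N ^+ 2 / (2 * L ^+ 2) <= p n.+1 ^+ 2 + p n ^+ 2.
Proof.
have a0 := a_gt0 0%N; have L_gt0 : 0 < L := lt_le_trans a0 (a_le 0%N).
rewrite ler_pdivrMr ?mulr_gt0 ?exprn_gt0//.
have [xL|xL] := leP (2 * L) `|x|.
  have p_ge1 m : 1 <= `|p m|.
    elim: m => [|m IHm]; first by rewrite p0 normr1.
    exact: le_trans IHm (norm_le_next m xL).
  have sqr_ge1 m : 1 <= p m ^+ 2 by rewrite -real_normK ?num_real// exprn_ege1.
  (* The sum of squares is at least 2, whereas a_0^2 / (2L^2) <= 1/2. *)
  have := sqr_ge1 n; have := sqr_ge1 n.+1; have := a_le 0%N.
  nra.
apply: le_trans (energy_ge n) _.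
have an := a_gt0 n; have anL := a_le n.
(* With p = p_n and q = p_(n+1): L (p^2 + q^2) + x p q = (2L + x)/4 (p + q)^2 + (2L - x)/4 (p -
   q)^2, where both coefficients are positive. *)
have xp : - (x * p n * p n.+1) <= L * (p n ^+ 2 + p n.+1 ^+ 2).
  move: xL; rewrite ltr_norml => /andP[xl xu].
  have := sqr_ge0 (p n + p n.+1); have := sqr_ge0 (p n - p n.+1).
  nra.
have s_ge0 : 0 <= p n ^+ 2 + p n.+1 ^+ 2 by rewrite addr_ge0 ?sqr_ge0.
(* Multiplying [xp] by a_n bounds the energy by (a_n^2 + a_n L) (p_n^2 + p_(n+1)^2). *)
have := ler_wpM2l (ltW an) xp.
have aL : a n ^+ 2 + a n * L <= 2 * L ^+ 2 by nra.
by have := ler_wpM2r s_ge0 aL; lra.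
Qed.

End ThreeTermRecurrence.

Theorem proposition3p1 (R : realType) (lambda : nat -> R) (L : R)
    (P : nat -> {poly R})
    (lambda_gt0 : forall n : nat, 0 < lambda n)
    (P_rec : jacobi_recurrence lambda P)
    (lambda_incr : nondecreasing_seq lambda)
    (lambda_cvg : lambda n @[n --> \oo] --> L) :
  (forall (x : R) (n : nat), (1 <= n)%N ->
     (P n).[x] ^+ 2 + (P n.-1).[x] ^+ 2 >= lambda 0%N ^+ 2 / (2 * L ^+ 2)) /\
  0 < inf [set y : R | exists (x : R) (n : nat),
             (1 <= n)%N /\ y = (P n.-1).[x] ^+ 2 + (P n).[x] ^+ 2].
Proof.
have [P0 PS] := P_rec.
have lambda_le n : lambda n <= L.
  rewrite -(cvg_lim (@Rhausdorff R) lambda_cvg).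
  by apply: nondecreasing_cvgn_le => //; apply/cvg_ex; exists L.
have bound (x : R) n : (1 <= n)%N ->
    (P n).[x] ^+ 2 + (P n.-1).[x] ^+ 2 >= lambda 0%N ^+ 2 / (2 * L ^+ 2).
  case: n => // n _.
  apply: (@sqr_sum_ge _ lambda (fun k => (P k).[x]) x) => //.
  - by move=> k; exact: lambda_incr.
  - by rewrite P0 hornerC.
  (* Evaluation at [x] turns the polynomial recurrence into the scalar one; the case split on [k]
     matches the zero polynomial P_(-1) with the scalar 0. *)
  - move=> k; have /(congr1 (horner^~ x)) := PS k.
    rewrite hornerD !hornerZ mulrC hornerMX mulrC => ->.
    by case: k => //=; rewrite hornerC.
split=> //.
have L_gt0 : 0 < L := lt_le_trans (lambda_gt0 0%N) (lambda_le 0%N).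
apply: (@lt_le_trans _ _ (lambda 0%N ^+ 2 / (2 * L ^+ 2))).
  by rewrite divr_gt0 ?mulr_gt0 ?exprn_gt0.
(* Nonemptiness matters, as [inf] of the empty set is 0 by default; the point x = 0, n = 1 serves as
   witness. *)
apply: lb_le_inf; first by exists ((P 0).[0] ^+ 2 + (P 1).[0] ^+ 2), 0, 1%N.
by move=> _ [x [n [n1 ->]]]; rewrite addrC; exact: bound.
Qed.
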